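(* Let $\mathcal C$ be a nonempty, at most countable index set, let $w_c>0$ with $\sum_{c\in\mathcal C}w_c=1$, and let $p=\sum_{c\in\mathcal C}w_cp_c$, where each $p_c$ is a probability density on $\mathbb{R}^d$ and $p$ has a continuously differentiable density. Let $T>0$, $\alpha=e^{-T}$. Let $C$ have law $\mathbb P(C=c)=w_c$, let $X_0\mid C=c\sim p_c$, and let $X_T\mid (X_0,C)\sim\mathcal N(\sqrt\alpha X_0,(1-\alpha)I_d)$. Put $$\tilde\rho_{\max}^2:=\rho_{\max}\big((X_0,C),X_T\big)^2,\quad \rho_{\mathrm{lab}}^2:=\rho_{\max}(C,X_T)^2,\quad \rho_c^2:=\rho_{\max}(X_0,X_T\mid C=c)^2,$$ the last being computed under the conditional law of $(X_0,X_T)$ given $C=c$. Then $$\tilde\rho_{\max}^2\le\rho_{\mathrm{lab}}^2+(1-\rho_{\mathrm{lab}}^2)\max_{c\in\mathcal C}\rho_c^2 .$$ Consequently, if $P$ is the Markov kernel on $\mathbb{R}^d$ which from the current state $X_0$ draws $X_T\mid X_0$ and then draws the next state from the conditional law of $X_0$ given $X_T$ (where $X_0\sim p$), then $$\mathrm{Gap}(P)\ge(1-\rho_{\mathrm{lab}}^2)\Big(1-\max_{c\in\mathcal C}\rho_c^2\Big).$$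
   Context: For random elements $U,V$ on a common probability space, the maximal correlation is $\rho_{\max}(U,V)^2=\sup\mathrm{Corr}(f(U),g(V))^2$ over non-constant (a.s.) square-integrable $f(U)$, $g(V)$ (the supremum over an empty set being $0$). If $\mathcal C$ is infinite, $\max_{c}$ is read as $\sup_c$. With $(Pf)(x)=\int f(y)P(x,dy)$, the spectral gap is $$\mathrm{Gap}(P)=1-\sup_{f\in L^2(p),\ \mathbb E_{p}[f]=0,\ f\ne0}\frac{\langle f,Pf\rangle_{L^2(p)}}{\|f\|^2_{L^2(p)}} .$$ *)

(* Defs.v *)
From HB Require Import structures.
From mathcomp Require Import all_boot all_order all_algebra.
From mathcomp Require Import all_classical all_reals all_analysis.
From mathcomp Require Import measurable_realfun.

Set Implicit Arguments.
Unset Strict Implicit.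
Unset Printing Implicit Defensive.

Import Order.TTheory GRing.Theory Num.Theory.
Import numFieldNormedType.Exports.

Local Open Scope classical_set_scope.
Local Open Scope ring_scope.

(* R^d is [d.-tuple R], with the product sigma-algebra that the library puts on
   tuples. *)

(* A copy of [C] carrying the sigma-algebra of all its subsets. *)
Definition discrete_space (C : pointedType) : Type := C.

HB.instance Definition _ (C : pointedType) := Pointed.on (discrete_space C).
HB.instance Definition _ (C : pointedType) :=
  @isMeasurable.Build default_measure_display (discrete_space C)
    (@discrete_measurable C) (@discrete_measurable0 C)
    (@discrete_measurableC C) (@discrete_measurableU C).

Definition tuple_cons (R : realType) (n : nat) (z : n.-tuple R * R) :
  n.+1.-tuple R := [tuple of z.2 :: z.1].

Lemma measurable_tuple_cons (R : realType) (n : nat) :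
  measurable_fun [set: n.-tuple R * R] (@tuple_cons R n).
Proof. exact: measurable_cons. Qed.

Section lebesgue_tuple_step.
Context (R : realType) (n : nat) (mu : {measure set (n.-tuple R) -> \bar R}).

(* If [mu] is Lebesgue measure on R^n, this is Lebesgue measure on R^(n+1). *)
Definition lebesgue_tuple_step : set (n.+1.-tuple R) -> \bar R :=
  pushforward (mu \x lebesgue_measure)%E (@tuple_cons R n).

Let step0 : lebesgue_tuple_step set0 = 0%E.
Proof. by rewrite /lebesgue_tuple_step /pushforward preimage_set0 measure0. Qed.

Let step_ge0 A : (0 <= lebesgue_tuple_step A)%E.
Proof. by rewrite /lebesgue_tuple_step /pushforward measure_ge0. Qed.

Let step_sigma_additive : semi_sigma_additive lebesgue_tuple_step.
Proof.
by apply: measure_semi_sigma_additive; exact: measurable_tuple_cons.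
Qed.

HB.instance Definition _ := isMeasure.Build _ _ _ lebesgue_tuple_step
  step0 step_ge0 step_sigma_additive.

End lebesgue_tuple_step.

(* Lebesgue measure on R^n, on its Borel sets; R^0 is a point of mass 1. *)
Fixpoint lebesgue_tuple (R : realType) (n : nat) :
    {measure set (n.-tuple R) -> \bar R} :=
  match n with
  | 0 => dirac [tuple]
  | m.+1 => lebesgue_tuple_step (lebesgue_tuple R m)
  end.

Section distributions.
Local Open Scope ereal_scope.
Context (R : realType) (d : nat).
Implicit Types f : d.-tuple R -> R.

Definition probability_density f :=
  [/\ measurable_fun setT f, (forall x, 0 <= f x)%R
    & \int[lebesgue_tuple R d]_x (f x)%:E = 1].

Definition density_law f (A : set (d.-tuple R)) : \bar R :=
  \int[lebesgue_tuple R d]_(x in A) (f x)%:E.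

(* N(m, s^2 I_d); the parameter [s] of [normal_pdf] is the standard deviation. *)
Definition isotropic_gaussian (m : d.-tuple R) (s : R) :=
  density_law (fun y => \prod_(i < d) normal_pdf (tnth m i) s (tnth y i))%R.

(* The topology of R^d is that of row vectors; C^1 means that all the partial
   derivatives exist and are continuous. *)
Definition continuously_differentiable f :=
  let g := fun v : 'rV[R]_d => f [tuple v ord0 i | i < d] in
  forall i : 'I_d, (forall v, derivable g v (delta_mx ord0 i)) /\
    continuous (fun v => 'D_(delta_mx ord0 i) g v).

End distributions.

Section random_elements.
Local Open Scope ereal_scope.
Context d1 d2 (S1 : measurableType d1) (S2 : measurableType d2) (R : realType).
Context dO (Omega : measurableType dO) (P : probability Omega R).
Implicit Types (U : Omega -> S1) (V : Omega -> S2).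

(* The conditional law of [V] given [U = u] is [k u]. *)
Definition conditional_law U V (k : S1 -> set S2 -> \bar R) :=
  forall B, measurable B ->
    measurable_fun setT (k ^~ B) /\
    forall A, measurable A ->
      P (U @^-1` A `&` V @^-1` B) = \int[P]_(w in U @^-1` A) k (U w) B.

Definition correlation (X Y : Omega -> R) : R :=
  (fine (covariance P X Y) / Num.sqrt (fine 'V_P[X] * fine 'V_P[Y]))%R.

Definition ae_constant (X : Omega -> R) :=
  exists r, {ae P, forall w, X w = r}.

(* The square of the maximal correlation. The real [sup] of the empty set is 0,
   and squared correlations are bounded by 1. *)
Definition maximal_correlation2 U V : R :=
  sup [set r | exists (f : S1 -> R) (g : S2 -> R),
    [/\ measurable_fun setT f /\ measurable_fun setT g,
        f \o U \in Lfun P 2%:E /\ g \o V \in Lfun P 2%:E,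
        ~ ae_constant (f \o U) /\ ~ ae_constant (g \o V)
      & r = (correlation (f \o U) (g \o V) ^+ 2)%R]].

End random_elements.

(* P( . | X = c); meaningful when P(X = c) > 0. *)
Definition conditioned (R : realType) (C : pointedType) (dO : measure_display)
    (Omega : measurableType dO) (P : probability Omega R)
    (X : {RV P >-> discrete_space C}) (c : C) : probability Omega R :=
  mnormalize
    (mrestr P (measurable_funPTI X (I : measurable [set (c : discrete_space C)])))
    P.

Section spectral_gap.
Context dS (S : measurableType dS) (R : realType).

Definition markov_operator (K : S -> {measure set S -> \bar R}) (f : S -> R) :
  S -> R := fun x => \int[K x]_y f y.

(* The nonzero centered elements of L^2(p); the elements of L^2(p) are
   represented by functions, so nonzero means not almost everywhere 0. *)
Definition centered (p : probability S R) : set (S -> R) :=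
  [set f | [/\ f \in Lfun p 2%:E, \int[p]_x f x = 0
             & ~ {ae p, forall x, f x = 0}]].

(* When [p] is invariant for [K], the integral defining [markov_operator K f]
   converges p-almost everywhere for [f] in L^2(p), and the Rayleigh quotients
   are at most 1. *)
Definition spectral_gap (p : probability S R)
    (K : S -> {measure set S -> \bar R}) : \bar R :=
  let rayleigh f :=
    (\int[p]_x (f x * markov_operator K f x)) / (\int[p]_x (f x ^+ 2)) in
  (1 - ereal_sup [set (rayleigh f)%:E | f in centered p])%E.

End spectral_gap.

(* Main.v *)
Require Import Defs.
From HB Require Import structures.
From mathcomp Require Import all_boot all_order all_algebra.
From mathcomp Require Import all_classical all_reals all_analysis.
From mathcomp Require Import measurable_realfun.
From mathcomp Require Import ring.

Set Implicit Arguments.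
Unset Strict Implicit.
Unset Printing Implicit Defensive.

Import Order.TTheory GRing.Theory Num.Theory.
Import numFieldNormedType.Exports.

Local Open Scope classical_set_scope.
Local Open Scope ring_scope.

(* Let X = f(X_0, C) and Y = g(X_T) be centered, and let X', Y' be their
   conditional means given C.  Then E[XY] = E[X'Y'] + E[(X - X')(Y - Y')].  The
   first term is at most |X'| |Y'|, the second at most rho |X - X'| |Y - Y'| with
   rho^2 = max_c rho_c^2, by conditioning on C.  By Pythagoras and Cauchy-Schwarz,
     E[XY]^2 <= |X|^2 (|Y'|^2 + rho^2 (|Y|^2 - |Y'|^2)),
   and |Y'|^2 = E[Y'Y] gives |Y'|^2 <= rho_lab^2 |Y|^2.  For the gap,
   <f, Pf> = E[h(X_T)^2] with h(X_T) = E[f(X_0) | X_T], and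
   E[h(X_T)^2] = E[f(X_0) h(X_T)] is bounded through the maximal correlation of
   (X_0, C) and X_T. *)

Lemma discriminant_le0 (R : realType) (a b c : R) : 0 <= c ->
  (forall t, 0 <= a - 2 * t * b + t ^+ 2 * c) -> b ^+ 2 <= a * c.
Proof.
rewrite le_eqVlt => /predU1P[<-|c_gt0] h.
  have [->|b0] := eqVneq b 0; first by rewrite expr0n/= mulr0.
  have := h ((a + 1) / (2 * b)).
  rewrite (_ : _ - _ + _ = -1); first by rewrite ler0N1.
  by field; exact: b0.
have := h (b / c); rewrite (_ : _ - _ + _ = (a * c - b ^+ 2) / c); last first.
  by field; rewrite gt_eqF.
by rewrite pmulr_lge0 ?invr_gt0// subr_ge0.
Qed.

Section square_integrable.
Context d (T : measurableType d) (R : realType).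

Lemma Lfun2P (mu : {measure set T -> \bar R}) (X : T -> R) :
  X \in Lfun mu 2%:E <->
  measurable_fun setT X /\ (\int[mu]_x (X x ^+ 2)%:E < +oo)%E.
Proof.
split.
  move=> /[dup] X2; rewrite inE => /andP[/[1!inE]/= mX _]; split => //.
  exact/integrable_lty/Lfun2_integrable_sqr.
move=> [mX X2]; rewrite inE; apply/andP; split; rewrite inE//=.
rewrite /finite_norm unlock /Lnorm poweR_lty//=.
rewrite (eq_integral (fun x => (X x ^+ 2)%:E))// => x _.
by rewrite powR_mulrn// real_normK// num_real.
Qed.

Lemma ae_eq_Rintegral (mu : {measure set T -> \bar R}) (X Y : T -> R) :
  measurable_fun setT X -> measurable_fun setT Y ->
  {ae mu, forall x, X x = Y x} -> \int[mu]_x X x = \int[mu]_x Y x.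
Proof.
move=> mX mY XY; congr fine; apply: ae_eq_integral => //.
- exact/measurable_EFinP.
- exact/measurable_EFinP.
- by apply: filterS XY => x /= ->.
Qed.

Lemma Lfun2_measurable (mu : {measure set T -> \bar R}) (X : T -> R) :
  X \in Lfun mu 2%:E -> measurable_fun setT X.
Proof. by move=> /Lfun2P[]. Qed.

Context (P : probability T R).
Implicit Types X Y : T -> R.

Lemma Lfun2_integrable X : X \in Lfun P 2%:E ->
  P.-integrable setT (EFin \o X).
Proof.
by move=> X2; apply/Lfun1_integrable/Lfun_subset12 => //; rewrite fin_num_measure.
Qed.

Lemma Lfun2_integrableM X Y : X \in Lfun P 2%:E -> Y \in Lfun P 2%:E ->
  P.-integrable setT (EFin \o (fun w => X w * Y w)).
Proof. by move=> X2 Y2; exact/Lfun1_integrable/Lfun2_mul_Lfun1. Qed.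

Lemma Lfun2_center X r : X \in Lfun P 2%:E ->
  (fun w => X w - r) \in Lfun P 2%:E.
Proof.
move=> X2; rewrite [X in X \in _](_ : _ = X - cst r)//.
by rewrite rpredB// ?lee1n// => *; exact: Lfun_cst.
Qed.

Lemma covariance_Rintegral X Y : X \in Lfun P 2%:E -> Y \in Lfun P 2%:E ->
  covariance P X Y =
  (\int[P]_w (X w * Y w) - \int[P]_w X w * \int[P]_w Y w)%:E.
Proof.
move=> X2 Y2.
have Pfin : P setT \is a fin_num by rewrite fin_num_measure.
rewrite covarianceE; [|exact: Lfun_subset12|exact: Lfun_subset12
  |exact: Lfun2_mul_Lfun1].
have XY := Lfun2_integrableM X2 Y2.
have iX := Lfun2_integrable X2; have iY := Lfun2_integrable Y2.
rewrite unlock EFinB EFinM !fineK//; exact: integrable_fin_num.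
Qed.

Lemma integral_sqr_ge0 X : 0 <= \int[P]_w (X w ^+ 2).
Proof. by apply: Rintegral_ge0 => w _; rewrite sqr_ge0. Qed.

Lemma Rintegral_quadratic X Y a b c :
  X \in Lfun P 2%:E -> Y \in Lfun P 2%:E ->
  \int[P]_w (a * X w ^+ 2 + b * (X w * Y w) + c * Y w ^+ 2) =
  a * \int[P]_w (X w ^+ 2) + b * \int[P]_w (X w * Y w) +
  c * \int[P]_w (Y w ^+ 2).
Proof.
move=> X2 Y2.
have iXX := Lfun2_integrable_sqr X2.
have iYY := Lfun2_integrable_sqr Y2.
have iXY := Lfun2_integrableM X2 Y2.
have Z (r : R) Z : P.-integrable setT (EFin \o Z) ->
  P.-integrable setT (EFin \o (fun w => r * Z w)) by exact: integrableZl.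
rewrite !RintegralD ?RintegralZl//; try exact: Z.
rewrite [X in integrable _ _ X](_ : _ =
  (EFin \o (fun w => a * X w ^+ 2)%R) \+ (EFin \o (fun w => b * (X w * Y w))%R))//.
by apply: integrableD => //; exact: Z.
Qed.

Lemma cauchy_schwarz X Y : X \in Lfun P 2%:E -> Y \in Lfun P 2%:E ->
  (\int[P]_w (X w * Y w)) ^+ 2 <=
  \int[P]_w (X w ^+ 2) * \int[P]_w (Y w ^+ 2).
Proof.
move=> X2 Y2; apply: discriminant_le0; first exact: integral_sqr_ge0.
move=> t; rewrite (_ : _ - _ + _ = \int[P]_w ((X w - t * Y w) ^+ 2)).
  exact: integral_sqr_ge0.
have -> : \int[P]_w ((X w - t * Y w) ^+ 2) = \int[P]_w
    (1 * X w ^+ 2 + (- (2 * t)) * (X w * Y w) + t ^+ 2 * Y w ^+ 2).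
  by apply: eq_Rintegral => w _; ring.
by rewrite Rintegral_quadratic//; ring.
Qed.

Lemma Rintegral_probability_cst (r : R) : \int[P]__ r = r.
Proof.
have P1 : P setT = 1%E := probability_setT P.
by rewrite Rintegral_cst// [X in fine X](_ : _ = 1%E)//= mulr1.
Qed.

Lemma Rintegral_center X Y : X \in Lfun P 2%:E -> Y \in Lfun P 2%:E ->
  \int[P]_w ((X w - \int[P]_v X v) * (Y w - \int[P]_v Y v)) =
  \int[P]_w (X w * Y w) - \int[P]_w X w * \int[P]_w Y w.
Proof.
move=> X2 Y2; set x := \int[P]_v X v; set y := \int[P]_v Y v.
have iX := Lfun2_integrable X2; have iY := Lfun2_integrable Y2.
have iXY := Lfun2_integrableM X2 Y2.
have Z (r : R) Z : P.-integrable setT (EFin \o Z) ->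
  P.-integrable setT (EFin \o (fun w => r * Z w)) by exact: integrableZl.
have D Z1 Z2 : P.-integrable setT (EFin \o Z1) ->
  P.-integrable setT (EFin \o Z2) ->
  P.-integrable setT (EFin \o (fun w => Z1 w + Z2 w)).
  by move=> i1 i2; exact: (integrableD measurableT i1 i2).
have ic : P.-integrable setT (EFin \o cst (x * y)).
  exact: finite_measure_integrable_cst.
transitivity (\int[P]_w
    (((X w * Y w + (- y) * X w) + (- x) * Y w) + x * y)).
  by apply: eq_Rintegral => w _; ring.
have i1 := D _ _ iXY (Z (- y) _ iX); have i2 := D _ _ i1 (Z (- x) _ iY).
rewrite (RintegralD measurableT i2 ic) (RintegralD measurableT i1 (Z _ _ iY)).
rewrite (RintegralD measurableT iXY (Z _ _ iX)).
by rewrite Rintegral_probability_cst !RintegralZl// -/x -/y; ring.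
Qed.

Lemma sqr_Rintegral_le X : X \in Lfun P 2%:E ->
  (\int[P]_w X w) ^+ 2 <= \int[P]_w (X w ^+ 2).
Proof.
move=> X2; rewrite -subr_ge0.
have := Rintegral_center X2 X2; rewrite -expr2 => h.
under eq_Rintegral => w _ do rewrite expr2.
rewrite -h; apply: Rintegral_ge0 => w _; rewrite -expr2; exact: sqr_ge0.
Qed.

Lemma correlationE X Y : X \in Lfun P 2%:E -> Y \in Lfun P 2%:E ->
  correlation P X Y ^+ 2 =
  (\int[P]_w (X w * Y w) - \int[P]_w X w * \int[P]_w Y w) ^+ 2 /
  ((\int[P]_w (X w ^+ 2) - (\int[P]_w X w) ^+ 2) *
   (\int[P]_w (Y w ^+ 2) - (\int[P]_w Y w) ^+ 2)).
Proof.
move=> X2 Y2; rewrite /correlation /variance !covariance_Rintegral//=.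
rewrite expr_div_n sqr_sqrtr//; rewrite mulr_ge0// subr_ge0.
  exact: sqr_Rintegral_le.
exact: sqr_Rintegral_le.
Qed.

Lemma covariance_sqr_le X Y : X \in Lfun P 2%:E -> Y \in Lfun P 2%:E ->
  (\int[P]_w (X w * Y w) - \int[P]_w X w * \int[P]_w Y w) ^+ 2 <=
  ((\int[P]_w (X w ^+ 2) - (\int[P]_w X w) ^+ 2) *
   (\int[P]_w (Y w ^+ 2) - (\int[P]_w Y w) ^+ 2)).
Proof.
move=> X2 Y2; rewrite -Rintegral_center//.
apply: (le_trans (cauchy_schwarz (Lfun2_center _ X2) (Lfun2_center _ Y2))).
under eq_Rintegral => w _ do rewrite expr2.
rewrite Rintegral_center//.
under [X in _ * X <= _]eq_Rintegral => w _ do rewrite expr2.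
by rewrite Rintegral_center.
Qed.

Lemma correlation_sqr_le1 X Y : X \in Lfun P 2%:E -> Y \in Lfun P 2%:E ->
  correlation P X Y ^+ 2 <= 1.
Proof.
move=> X2 Y2; rewrite correlationE//; have cv := covariance_sqr_le X2 Y2.
set v := (X in _ / X); rewrite -/v in cv.
have v0 : 0 <= v by rewrite (le_trans _ cv)// sqr_ge0.
have [->|vN0] := eqVneq v 0; first by rewrite invr0 mulr0.
by rewrite ler_pdivrMr ?mul1r// lt_neqAle eq_sym vN0.
Qed.

Lemma ae_constant_variance X : X \in Lfun P 2%:E -> ae_constant P X ->
  \int[P]_w (X w ^+ 2) - (\int[P]_w X w) ^+ 2 = 0.
Proof.
move=> X2 [r Xr]; have mX := Lfun2_measurable X2.
rewrite (@ae_eq_Rintegral P X (cst r))// (@ae_eq_Rintegral P _ (cst (r ^+ 2))).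
- by rewrite !Rintegral_probability_cst subrr.
- exact: measurable_funX.
- exact: measurable_cst.
- by apply: filterS Xr => w /= ->.
Qed.

End square_integrable.

Section maximal_correlation.
Context d1 d2 (S1 : measurableType d1) (S2 : measurableType d2) (R : realType).
Context dO (Omega : measurableType dO) (P : probability Omega R).
Variables (U : Omega -> S1) (V : Omega -> S2).

Lemma maximal_correlation2_le1 : maximal_correlation2 P U V <= 1.
Proof.
rewrite /maximal_correlation2; set A := (X in sup X).
have [[r Ar]|A0] := pselect (A !=set0).
  apply: ge_sup; first by exists r.
  by move=> _ [f [g [_ [f2 g2] _ ->]]]; exact: correlation_sqr_le1.
by rewrite sup_out// => -[].
Qed.

Lemma maximal_correlation2_ge0 : 0 <= maximal_correlation2 P U V.
Proof.
rewrite /maximal_correlation2; set A := (X in sup X).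
have [[r Ar]|A0] := pselect (A !=set0); last by rewrite sup_out// => -[].
have r0 : 0 <= r by case: Ar => f [g [_ _ _ ->]]; exact: sqr_ge0.
apply: (le_trans r0); apply: ub_le_sup => //.
by exists 1 => _ [f [g [_ [f2 g2] _ ->]]]; exact: correlation_sqr_le1.
Qed.

Lemma covariance_le_maximal_correlation f g :
  measurable_fun setT f -> measurable_fun setT g ->
  f \o U \in Lfun P 2%:E -> g \o V \in Lfun P 2%:E ->
  (\int[P]_w (f (U w) * g (V w)) -
   \int[P]_w f (U w) * \int[P]_w g (V w)) ^+ 2 <=
  maximal_correlation2 P U V *
  ((\int[P]_w (f (U w) ^+ 2) - (\int[P]_w f (U w)) ^+ 2) *
   (\int[P]_w (g (V w) ^+ 2) - (\int[P]_w g (V w)) ^+ 2)).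
Proof.
move=> mf mg f2 g2.
set v1 := (X in _ <= _ * (X * _)); set v2 := (X in _ <= _ * (_ * X)).
have v1_ge0 : 0 <= v1 by rewrite subr_ge0; exact: (sqr_Rintegral_le f2).
have v2_ge0 : 0 <= v2 by rewrite subr_ge0; exact: (sqr_Rintegral_le g2).
have cov_le := covariance_sqr_le f2 g2.
have [v10|v1N0] := eqVneq v1 0.
  by rewrite v10 mul0r mulr0 (le_trans cov_le)//= -/v1 v10 mul0r.
have [v20|v2N0] := eqVneq v2 0.
  by rewrite v20 mulr0 mulr0 (le_trans cov_le)//= -/v2 v20 mulr0.
rewrite -ler_pdivrMr; last by rewrite mulr_gt0// lt_neqAle eq_sym ?v1N0 ?v2N0.
have := correlationE f2 g2; rewrite /= -/v1 -/v2 => <-.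
apply: ub_le_sup.
  by exists 1 => _ [? [? [_ [? ?] _ ->]]]; exact: correlation_sqr_le1.
exists f, g; split => //; split.
  by move=> /(ae_constant_variance f2) /eqP; exact/negP.
by move=> /(ae_constant_variance g2) /eqP; exact/negP.
Qed.

End maximal_correlation.

Section disintegration.
Context d1 d2 (S1 : measurableType d1) (S2 : measurableType d2) (R : realType).
Context dO (Omega : measurableType dO) (P : probability Omega R).
Variables (U : {RV P >-> S1}) (V : {RV P >-> S2}) (K : R.-pker S1 ~> S2).

Let state (z : (unit * S1) * S2) : S1 * S2 := (z.1.2, z.2).

Let measurable_state : measurable_fun setT state.
Proof.
apply/measurable_fun_pairP; split => /=; last exact: measurable_snd.
exact: (measurableT_comp measurable_snd measurable_fst).
Qed.

Let law : unit -> pprobability S1 R := fun=> distribution P U.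

Let measurable_law : measurable_fun setT law.
Proof. exact: measurable_cst. Qed.

(* The law of U times K; composing library kernels gives integral_kcomp. *)
Let joint : {measure set (S1 * S2) -> \bar R} :=
  mkcomp (kprobability measurable_law)
    (mkcomp (kernel.kernel_snd K) (kdirac measurable_state)) tt.

Let measurable_inner (phi : S1 * S2 -> \bar R) :
  (forall z, 0 <= phi z)%E -> measurable_fun setT phi ->
  measurable_fun setT (fun u => \int[K u]_v phi (u, v))%E.
Proof. by move=> phi0 mphi; exact: measurable_fun_integral_finite_kernel. Qed.

Let integral_joint (phi : S1 * S2 -> \bar R) :
  (forall z, 0 <= phi z)%E -> measurable_fun setT phi ->
  (\int[joint]_z phi z = \int[P]_w \int[K (U w)]_v phi (U w, v))%E.
Proof.
move=> phi0 mphi.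
rewrite integral_kcomp//=.
rewrite -(@ge0_integral_distribution _ _ _ _ _ _ U
  (fun u => \int[K u]_v phi (u, v))%E); [|exact: measurable_inner|by move=> *; exact: integral_ge0].
apply: eq_integral => u _.
rewrite integral_kcomp//=.
apply: eq_integral => v _.
by rewrite integral_dirac// diracT mul1e.
Qed.

Hypothesis UVK : conditional_law P U V (fun u => K u).

Let joint_rectangle A B : measurable A -> measurable B ->
  joint (A `*` B) = P (U @^-1` A `&` V @^-1` B).
Proof.
move=> mA mB.
have mAB : measurable (A `*` B) by exact: measurableX.
rewrite (UVK mB).2//.
have -> : joint (A `*` B) = (\int[joint]_z (\1_(A `*` B) z)%:E)%E.
  by rewrite integral_indic// setIT.
rewrite (@integral_joint (fun z => (\1_(A `*` B) z)%:E)); last 2 first.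
  by move=> z; rewrite lee_fin.
  exact/measurable_EFinP.
rewrite [RHS]integral_mkcond; apply: eq_integral => w _.
rewrite patchE; case: ifPn => [/set_mem UA|/negP UA].
  rewrite (eq_integral (fun v => (\1_B v)%:E)); last first.
    by move=> v _; rewrite !indicE in_setX /= (mem_set (UA : A (U w))).
  by rewrite integral_indic// setIT.
rewrite integral0_eq// => v _.
rewrite indicE in_setX/= (_ : U w \in A = false)//.
by apply/negP => /set_mem UwA; apply: UA; exact/mem_set.
Qed.

Let UV w := (U w, V w).

Let measurable_UV : measurable_fun setT UV.
Proof. by apply/measurable_fun_pairP; split; exact: measurable_funPT. Qed.

Lemma ge0_disintegration (phi : S1 * S2 -> \bar R) :
  (forall z, 0 <= phi z)%E -> measurable_fun setT phi ->
  (\int[P]_w phi (U w, V w) = \int[P]_w \int[K (U w)]_v phi (U w, v))%E.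
Proof.
move=> phi0 mphi; rewrite -integral_joint//.
transitivity (\int[pushforward P UV]_z phi z)%E.
  by rewrite ge0_integral_pushforward.
apply: eq_measure_integral => A mA _.
pose G := [set A `*` B | A in @measurable _ S1 & B in @measurable _ S2].
apply: (measure_unique G (fun=> setT)) => //.
- exact: measurable_prod_measurableType.
- move=> _ _ [A1 mA1 [B1 mB1 <-]] [A2 mA2 [B2 mB2 <-]].
  exists (A1 `&` A2); first exact: measurableI.
  exists (B1 `&` B2); first exact: measurableI.
  by rewrite setXI.
- by move=> _; exists setT => //; exists setT => //; rewrite setXTT.
- by rewrite bigcup_const.
- by move=> _ [A' mA' [B mB <-]]; rewrite [RHS]joint_rectangle.
- by move=> _; rewrite /= /pushforward preimage_setT probability_setT ltry.
Qed.


Let measurable_funepos_EFin (phi : S1 * S2 -> R) : measurable_fun setT phi ->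
  measurable_fun setT (EFin \o phi)^\+%E.
Proof. by move=> mphi; apply: measurable_funepos; exact/measurable_EFinP. Qed.

Let measurable_funeneg_EFin (phi : S1 * S2 -> R) : measurable_fun setT phi ->
  measurable_fun setT (EFin \o phi)^\-%E.
Proof. by move=> mphi; apply: measurable_funeneg; exact/measurable_EFinP. Qed.

Let integral_posneg (phi : S1 * S2 -> R) u :
  (\int[K u]_v (phi (u, v))%:E =
   \int[K u]_v (EFin \o phi)^\+ (u, v) - \int[K u]_v (EFin \o phi)^\- (u, v))%E.
Proof.
rewrite integralE; congr (_ - _)%E; apply: eq_integral => v _.
  by rewrite !funeposE.
by rewrite !funenegE.
Qed.

Lemma measurable_section_Rintegral (phi : S1 * S2 -> R) :
  measurable_fun setT phi ->
  measurable_fun setT (fun u => \int[K u]_v phi (u, v)).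
Proof.
move=> mphi; apply: measurableT_comp => //.
rewrite (_ : (fun u => _) = (fun u =>
    \int[K u]_v (EFin \o phi)^\+ (u, v) -
    \int[K u]_v (EFin \o phi)^\- (u, v))%E); last first.
  by apply/funext => u; rewrite integral_posneg.
apply: emeasurable_funB.
  exact: measurable_inner (funepos_ge0 _) (measurable_funepos_EFin mphi).
exact: measurable_inner (funeneg_ge0 _) (measurable_funeneg_EFin mphi).
Qed.

Lemma ge0_disintegration_integrable (phi : S1 * S2 -> \bar R) :
  (forall z, 0 <= phi z)%E -> measurable_fun setT phi ->
  (\int[P]_w phi (U w, V w) < +oo)%E ->
  P.-integrable setT (fun w => \int[K (U w)]_v phi (U w, v))%E.
Proof.
move=> phi0 mphi phioo; apply/integrableP; split.
  exact: (measurableT_comp (measurable_inner phi0 mphi) (measurable_funPT U)).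
rewrite (eq_integral (fun w => \int[K (U w)]_v phi (U w, v))%E).
  by rewrite -ge0_disintegration.
by move=> w _; rewrite gee0_abs// integral_ge0.
Qed.

Variable phi : S1 * S2 -> R.
Hypothesis mphi : measurable_fun setT phi.
Hypothesis iphi : P.-integrable setT (fun w => (phi (U w, V w))%:E).

Lemma disintegration_ae :
  {ae P, forall w, (K (U w)).-integrable setT (fun v => (phi (U w, v))%:E)}.
Proof.
have /integrableP[_ iphioo] := iphi.
have mabs : measurable_fun setT (fun z => `|(phi z)%:E|%E).
  by apply: measurableT_comp => //; exact/measurable_EFinP.
have := ge0_disintegration_integrable (fun z => abse_ge0 (phi z)%:E) mabs iphioo.
move=> /(integrable_ae measurableT); apply: filterS => w /(_ I) wfin.
apply/integrableP; split; first exact/measurable_EFinP/measurableT_comp.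
by rewrite -ge0_fin_numE// integral_ge0.
Qed.

Let ipos : P.-integrable setT (fun w => (EFin \o phi)^\+ (U w, V w))%E.
Proof.
rewrite [X in integrable _ _ X](_ : _ =
  (fun w => (phi (U w, V w))%:E)^\+%E); first exact: integrable_funepos.
by apply/funext => w; rewrite !funeposE.
Qed.

Let ineg : P.-integrable setT (fun w => (EFin \o phi)^\- (U w, V w))%E.
Proof.
rewrite [X in integrable _ _ X](_ : _ =
  (fun w => (phi (U w, V w))%:E)^\-%E); first exact: integrable_funeneg.
by apply/funext => w; rewrite !funenegE.
Qed.

Let ipos_inner := ge0_disintegration_integrable (funepos_ge0 _)
  (measurable_funepos_EFin mphi) (integrable_lty measurableT ipos).

Let ineg_inner := ge0_disintegration_integrable (funeneg_ge0 _)
  (measurable_funeneg_EFin mphi) (integrable_lty measurableT ineg).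

Let inner_ae : {ae P, forall w, ((\int[K (U w)]_v phi (U w, v))%:E =
  \int[K (U w)]_v (EFin \o phi)^\+ (U w, v) -
  \int[K (U w)]_v (EFin \o phi)^\- (U w, v))%E}.
Proof.
apply: filterS disintegration_ae => w iw.
by rewrite -integral_posneg /Rintegral fineK// integrable_fin_num.
Qed.

Let measurable_inner_U :
  measurable_fun setT (fun w => (\int[K (U w)]_v phi (U w, v))%:E).
Proof.
apply/measurable_EFinP.
exact: (measurableT_comp (measurable_section_Rintegral mphi) (measurable_funPT U)).
Qed.

Lemma disintegration :
  \int[P]_w phi (U w, V w) = \int[P]_w \int[K (U w)]_v phi (U w, v).
Proof.
congr fine; rewrite integralE.
have iB := integrableB measurableT ipos_inner ineg_inner.
rewrite [RHS](ae_eq_integral (fun w =>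
  \int[K (U w)]_v (EFin \o phi)^\+ (U w, v) -
  \int[K (U w)]_v (EFin \o phi)^\- (U w, v))%E)//; first last.
- by apply: filterS inner_ae => w /= ->.
- exact: measurable_int iB.
rewrite integralB// -!ge0_disintegration//; try exact: measurable_funeneg_EFin;
  try exact: measurable_funepos_EFin.
congr (_ - _)%E; apply: eq_integral => w _; first by rewrite !funeposE.
by rewrite !funenegE.
Qed.

End disintegration.

Section kernel_at.
Context d1 d2 (S1 : measurableType d1) (S2 : measurableType d2) (R : realType).
Variable K : R.-pker S1 ~> S2.

(* The measures of a library kernel do not carry the probability structure. *)
Definition kernel_at (u : S1) : set S2 -> \bar R := K u.

HB.instance Definition _ u := Measure.on (kernel_at u).

HB.instance Definition _ u :=
  Measure_isProbability.Build d2 S2 R (kernel_at u) (prob_kernel u).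

Lemma sqr_kernel_Rintegral_le (b : S2 -> R) u : measurable_fun setT b ->
  (((\int[K u]_v b v) ^+ 2)%:E <= \int[K u]_v (b v ^+ 2)%:E)%E.
Proof.
move=> mb.
have [b2|] := ltP (\int[K u]_v (b v ^+ 2)%:E)%E +oo%E; last first.
  by rewrite leye_eq => /eqP ->; rewrite leey.
have bL : b \in Lfun (kernel_at u) 2%:E by apply/Lfun2P.
have := sqr_Rintegral_le bL.
rewrite -lee_fin => /le_trans; apply.
rewrite /Rintegral fineK//.
exact: integrable_fin_num (Lfun2_integrable_sqr bL).
Qed.

End kernel_at.

Section conditional_mean.
Context d1 d2 (S1 : measurableType d1) (S2 : measurableType d2) (R : realType).
Context dO (Omega : measurableType dO) (P : probability Omega R).
Variables (U : {RV P >-> S1}) (V : {RV P >-> S2}) (K : R.-pker S1 ~> S2).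
Hypothesis UVK : conditional_law P U V (fun u => K u).
Variable b : S2 -> R.
Hypothesis mb : measurable_fun setT b.
Hypothesis b2 : b \o V \in Lfun P 2%:E.

Lemma measurable_conditional_mean :
  measurable_fun setT (fun u => \int[K u]_v b v).
Proof.
apply: (measurable_section_Rintegral K (phi := fun z => b z.2)).
exact: measurableT_comp.
Qed.

Lemma conditional_mean_Lfun2 : (fun w => \int[K (U w)]_v b v) \in Lfun P 2%:E.
Proof.
have mm : measurable_fun setT (fun w => \int[K (U w)]_v b v).
  exact: (measurableT_comp measurable_conditional_mean (measurable_funPT U)).
apply/Lfun2P; split => //.
have /Lfun2P[_ b2oo] := b2.
have msq : measurable_fun setT (fun z : S1 * S2 => (b z.2 ^+ 2)%:E).
  apply/measurable_EFinP; apply: measurable_funX.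
  exact: measurableT_comp.
apply: le_lt_trans b2oo.
have := ge0_disintegration UVK (phi := fun z => (b z.2 ^+ 2)%:E).
move=> /(_ _ msq) -> //; last by move=> z; rewrite lee_fin sqr_ge0.
have mI : measurable_fun setT (fun w => \int[K (U w)]_v (b v ^+ 2)%:E)%E.
  apply: (@measurableT_comp _ _ _ _ _ _
    (fun u => \int[K u]_v (b v ^+ 2)%:E)%E) => //.
  apply: (measurable_fun_integral_kernel (measurable_kernel K)).
    by move=> v; rewrite lee_fin sqr_ge0.
  by apply/measurable_EFinP; exact: measurable_funX.
apply: ge0_le_integral => //.
- by move=> w _; rewrite lee_fin sqr_ge0.
- by apply/measurable_EFinP; exact: measurable_funX.
- by move=> w _; exact: sqr_kernel_Rintegral_le.
Qed.

Lemma conditional_mean_integrable :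
  {ae P, forall w, (K (U w)).-integrable setT (EFin \o b)}.
Proof.
apply: (disintegration_ae UVK (phi := fun z => b z.2)).
  exact: measurableT_comp.
exact: Lfun2_integrable b2.
Qed.

Lemma Rintegral_conditional_mean (a : S1 -> R) :
  measurable_fun setT a -> a \o U \in Lfun P 2%:E ->
  \int[P]_w (a (U w) * b (V w)) =
  \int[P]_w (a (U w) * \int[K (U w)]_v b v).
Proof.
move=> ma a2.
have mphi : measurable_fun setT (fun z : S1 * S2 => a z.1 * b z.2).
  by apply: measurable_funM; exact: measurableT_comp.
rewrite (disintegration UVK mphi); last exact: Lfun2_integrableM a2 b2.
apply: ae_eq_Rintegral.
- exact: (measurableT_comp (measurable_section_Rintegral K mphi) (measurable_funPT U)).
- apply: measurable_funM; first exact: Lfun2_measurable a2.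
  exact: Lfun2_measurable conditional_mean_Lfun2.
- by apply: filterS conditional_mean_integrable => w iw /=; rewrite RintegralZl.
Qed.

End conditional_mean.

Lemma mnormalize_mul d (T : measurableType d) (R : realType)
    (mu : {measure set T -> \bar R}) (Q : probability T R) (B : set T) :
  (0 < mu setT < +oo)%E -> (mnormalize mu Q B * mu setT = mu B)%E.
Proof.
move=> /andP[mu0 muoo]; rewrite /mnormalize gt_eqF//= lt_eqF//.
have fin : mu setT \is a fin_num by rewrite ge0_fin_numE// ltW.
rewrite -muleA -[X in (_ * X)%E](_ : 1%E = _) ?mule1//.
by rewrite -{2}(fineK fin) -EFinM mulVf// gt_eqF// -lte_fin fineK.
Qed.

Section discrete_conditioning.
Context (R : realType) (C : pointedType) (Ccountable : countable [set: C]).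
Context dO (Omega : measurableType dO) (P : probability Omega R).
Variable lab : {RV P >-> discrete_space C}.

Let measurable_lab (A : set C) : measurable (lab @^-1` A).
Proof. exact: measurable_funPTI. Qed.

Lemma ge0_integral_countable_label (psi : Omega -> \bar R) (A : set C) :
  measurable_fun setT psi -> (forall w, 0 <= psi w)%E ->
  (\int[P]_(w in lab @^-1` A) psi w =
   \esum_(c in A) \int[P]_(w in lab @^-1` [set c]) psi w)%E.
Proof.
move=> mpsi psi0.
have /countable_injP[code code_inj] := Ccountable.
pose F n := lab @^-1` [set c | A c /\ code c = n].
have -> : lab @^-1` A = \bigcup_n F n.
  apply/seteqP; split => [w Aw|w [n _ [//]]].
  by exists (code (lab w)).
rewrite ge0_integral_bigcup//; last 3 first.
  by move=> n; exact: measurable_lab.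
  exact: measurable_funTS.
  by apply/trivIsetP => i j _ _ ij; apply/seteqP; split => w //= -[[_ ci] [_ cj]];
    move: ij; rewrite -ci -cj eqxx.
have I0 n : (0 <= \int[P]_(w in F n) psi w)%E by apply: integral_ge0 => w _.
rewrite nneseries_esumT// (esumID (code @` A))//.
rewrite [X in (_ + X)%E]esum1 ?adde0; last first.
  move=> n [_ nA]; rewrite (_ : F n = set0) ?integral_set0//.
  by apply/seteqP; split => // w [Aw cw]; apply: nA; exists (lab w).
rewrite setTI esum_image; last first.
  by move=> x y xA yA; apply: code_inj; exact: in_setT.
apply: eq_esum => c Ac; congr (integral _ _ _).
apply/seteqP; split => w.
  by move=> [_ /code_inj]; apply; exact: in_setT.
by move=> wc; rewrite /F /= (wc : lab w = c).
Qed.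

Hypothesis lab_gt0 : forall c, (0 < P (lab @^-1` [set c]))%E.

Lemma conditionedE c B : measurable B ->
  (conditioned lab c B * P (lab @^-1` [set c]) =
   P (lab @^-1` [set c] `&` B))%E.
Proof.
move=> mB; rewrite setIC.
have PT : P (setT `&` lab @^-1` [set c]) = P (lab @^-1` [set c]).
  by rewrite setTI.
rewrite -{1}PT; apply: mnormalize_mul.
suff : (0 < P (setT `&` lab @^-1` [set c]) < +oo)%E by [].
by rewrite PT lab_gt0 ltey_eq fin_num_measure.
Qed.

Let law_given (c : discrete_space C) : pprobability Omega R := conditioned lab c.

Let measurable_law_given : measurable_fun setT law_given.
Proof. by []. Qed.

Definition conditioned_kernel : R.-pker discrete_space C ~> Omega :=
  kprobability measurable_law_given.

Lemma conditional_law_conditioned :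
  conditional_law P lab idfun (fun c => conditioned_kernel c).
Proof.
move=> B mB; split; first exact: measurable_kernel.
move=> A mA.
have mpsi : measurable_fun setT (fun w => conditioned_kernel (lab w) B).
  exact: (measurableT_comp (measurable_kernel conditioned_kernel B mB)).
rewrite ge0_integral_countable_label//.
transitivity (\int[P]_(w in lab @^-1` A) (\1_B w)%:E)%E.
  by rewrite integral_indic// setIC.
rewrite ge0_integral_countable_label//; last exact/measurable_EFinP.
apply: eq_esum => c _.
transitivity (conditioned lab c B * P (lab @^-1` [set c]))%E.
  by rewrite conditionedE// integral_indic// setIC.
rewrite (eq_integral (cst (conditioned lab c B))); last first.
  by move=> w /set_mem /= ->.
by rewrite integral_cst.
Qed.

End discrete_conditioning.

Lemma quadratic_ge0 (R : realType) (a b c t : R) : 0 <= a -> 0 <= c ->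
  b ^+ 2 <= a * c -> 0 <= a - 2 * t * b + t ^+ 2 * c.
Proof.
move=> a0 c0 bac.
have s0 : 0 <= a + t ^+ 2 * c by rewrite addr_ge0// mulr_ge0// sqr_ge0.
rewrite addrAC subr_ge0 (le_trans (ler_norm _))//.
rewrite -ler_sqr ?nnegrE// real_normK ?num_real//.
rewrite (@le_trans _ _ (4 * t ^+ 2 * (a * c)))//.
  rewrite (_ : (2 * t * b) ^+ 2 = 4 * t ^+ 2 * b ^+ 2); last by ring.
  by rewrite ler_wpM2l// mulr_ge0// sqr_ge0.
rewrite -subr_ge0 [leRHS](_ : _ = (a - t ^+ 2 * c) ^+ 2); last by ring.
exact: sqr_ge0.
Qed.

Lemma sqr_sum_le (R : realType) (e i a0 a1 b0 b1 : R) :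
  0 <= a0 -> 0 <= a1 -> 0 <= b0 -> 0 <= b1 ->
  e ^+ 2 <= a0 * b0 -> i ^+ 2 <= a1 * b1 ->
  (e + i) ^+ 2 <= (a0 + a1) * (b0 + b1).
Proof.
move=> a00 a10 b00 b10 eab iab; apply: discriminant_le0; first exact: addr_ge0.
move=> t.
have := addr_ge0 (quadratic_ge0 t a00 b00 eab) (quadratic_ge0 t a10 b10 iab).
by congr (0 <= _); ring.
Qed.

Section square_integrable_bilinear.
Context d (T : measurableType d) (R : realType) (P : probability T R).
Implicit Types X Y : T -> R.

Lemma Lfun2B X Y : X \in Lfun P 2%:E -> Y \in Lfun P 2%:E ->
  (fun w => X w - Y w) \in Lfun P 2%:E.
Proof.
by move=> X2 Y2; rewrite [X in X \in _](_ : _ = X - Y)// rpredB// lee1n.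
Qed.

Lemma Rintegral_mulB X X' Y Y' :
  X \in Lfun P 2%:E -> X' \in Lfun P 2%:E ->
  Y \in Lfun P 2%:E -> Y' \in Lfun P 2%:E ->
  \int[P]_w ((X w - X' w) * (Y w - Y' w)) =
  \int[P]_w (X w * Y w) - \int[P]_w (X' w * Y w) -
  (\int[P]_w (X w * Y' w) - \int[P]_w (X' w * Y' w)).
Proof.
move=> X2 X'2 Y2 Y'2.
have XX := Lfun2B X2 X'2.
rewrite -!RintegralB//; try exact: Lfun2_integrableM.
- by apply: eq_Rintegral => w _; ring.
- rewrite [X in integrable _ _ X](_ : _ =
    EFin \o (fun w => (X w - X' w) * Y w)); first exact: Lfun2_integrableM.
  by apply/funext => w /=; congr EFin; ring.
- rewrite [X in integrable _ _ X](_ : _ =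
    EFin \o (fun w => (X w - X' w) * Y' w)); first exact: Lfun2_integrableM.
  by apply/funext => w /=; congr EFin; ring.
Qed.

End square_integrable_bilinear.

Lemma covariance_le_maximal_correlation_ae d1 d2 (S1 : measurableType d1)
    (S2 : measurableType d2) (R : realType) dO (Omega : measurableType dO)
    (P : probability Omega R) (U : Omega -> S1) (V : Omega -> S2)
    (X : Omega -> R) (f : S1 -> R) (g : S2 -> R) :
  measurable_fun setT U -> measurable_fun setT f -> measurable_fun setT g ->
  X \in Lfun P 2%:E -> g \o V \in Lfun P 2%:E ->
  {ae P, forall w, X w = f (U w)} ->
  (\int[P]_w ((X w - \int[P]_v X v) * (g (V w) - \int[P]_v g (V v)))) ^+ 2 <=
  maximal_correlation2 P U V *
  (\int[P]_w ((X w - \int[P]_v X v) ^+ 2) *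
   \int[P]_w ((g (V w) - \int[P]_v g (V v)) ^+ 2)).
Proof.
move=> mU mf mg X2 g2 Xf.
have mX := Lfun2_measurable X2.
have mY := Lfun2_measurable g2.
have mfU : measurable_fun setT (f \o U) by exact: measurableT_comp.
have f2 : f \o U \in Lfun P 2%:E.
  have /Lfun2P[_ Xoo] := X2.
  apply/Lfun2P; split => //.
  rewrite (ae_eq_integral (fun w => (X w ^+ 2)%:E))//.
  - by apply/measurable_EFinP; exact: measurable_funX.
  - by apply/measurable_EFinP; exact: measurable_funX.
  - by apply: filterS Xf => w /= ->.
have := covariance_le_maximal_correlation mf mg f2 g2.
have EX : \int[P]_w X w = \int[P]_w f (U w) by exact: ae_eq_Rintegral.
have EXY : \int[P]_w (X w * g (V w)) = \int[P]_w (f (U w) * g (V w)).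
  apply: ae_eq_Rintegral; [exact: measurable_funM|exact: measurable_funM|].
  by apply: filterS Xf => w ->.
have EXX : \int[P]_w (X w * X w) = \int[P]_w (f (U w) ^+ 2).
  apply: ae_eq_Rintegral; [exact: measurable_funM|exact: measurable_funX|].
  by apply: filterS Xf => w ->; rewrite expr2.
have sq Z : \int[P]_w ((Z w - \int[P]_v Z v) ^+ 2) =
    \int[P]_w ((Z w - \int[P]_v Z v) * (Z w - \int[P]_v Z v)).
  by apply: eq_Rintegral => w _; rewrite expr2.
have EYY : \int[P]_w (g (V w) * g (V w)) = \int[P]_w (g (V w) ^+ 2).
  by apply: eq_Rintegral => w _; rewrite expr2.
by rewrite (sq X) (sq (g \o V)) !Rintegral_center//= EX EXY EXX EYY -!expr2.
Qed.

Section mixture.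
Context d1 d2 (S1 : measurableType d1) (S2 : measurableType d2) (R : realType).
Context (C : pointedType) (Ccountable : countable [set: C]).
Context dO (Omega : measurableType dO) (P : probability Omega R).
Variable lab : {RV P >-> discrete_space C}.
Hypothesis lab_gt0 : forall c, (0 < P (lab @^-1` [set c]))%E.
Variables (U : {RV P >-> S1}) (V : {RV P >-> S2}).

Let rho2_lab := maximal_correlation2 P lab V.
Let rho2 c := maximal_correlation2 (conditioned lab c) U V.
Let rho2_max := sup [set rho2 c | c in [set: C]].

Lemma rho2_le_max c : rho2 c <= rho2_max.
Proof.
apply: ub_le_sup; last by exists c.
by exists 1 => _ [c' _ <-]; exact: maximal_correlation2_le1.
Qed.

Lemma rho2_max_ge0 : 0 <= rho2_max.
Proof.
by apply: le_trans (rho2_le_max point); exact: maximal_correlation2_ge0.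
Qed.

Lemma rho2_max_le1 : rho2_max <= 1.
Proof.
apply: ge_sup; first by exists (rho2 point), point.
by move=> _ [c' _ <-]; exact: maximal_correlation2_le1.
Qed.

Lemma ae_label (Q : C -> Prop) : {ae P, forall w, Q (lab w)} -> forall c, Q c.
Proof.
move=> [N [mN N0 QN]] c; apply: contrapT => Qc.
have := lab_gt0 c; rewrite lt_neqAle => /andP[/negP + _]; apply.
rewrite eq_sym -measure_le0 -N0 le_measure ?inE//.
  exact: measurable_funPTI.
by move=> w wc; apply: QN => /=; rewrite (wc : lab w = c).
Qed.

Lemma conditioned_label_ae c : {ae conditioned lab c, forall w, lab w = c}.
Proof.
exists (lab @^-1` (~` [set c])); split => //.
  exact: measurable_funPTI.
have mc : measurable (lab @^-1` (~` [set c])) by exact: measurable_funPTI.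
have := conditionedE lab_gt0 c mc.
rewrite -preimage_setI setICr preimage_set0 measure0 => /eqP.
rewrite mule_eq0 => /orP[/eqP//|/eqP Pc].
by have := lab_gt0 c; rewrite Pc ltxx.
Qed.

Let K := conditioned_kernel lab.
Let id_mixin :=
  isMeasurableFun.Build _ _ Omega Omega idfun (@measurable_id _ Omega setT).
Let idRV : {RV P >-> Omega} := HB.pack (idfun : Omega -> Omega) id_mixin.
Let labK : conditional_law P lab idRV (fun c => K c) :=
  conditional_law_conditioned Ccountable lab_gt0.

Lemma conditioned_Lfun2 (X : Omega -> R) : X \in Lfun P 2%:E ->
  forall c, X \in Lfun (conditioned lab c) 2%:E.
Proof.
move=> X2; have mX := Lfun2_measurable X2; apply: ae_label.
have mphi : measurable_fun setT
    (fun z : discrete_space C * Omega => X z.2 ^+ 2).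
  by apply: measurable_funX; exact: measurableT_comp.
have := disintegration_ae labK mphi (Lfun2_integrable_sqr X2).
apply: filterS => w iX; apply/Lfun2P; split => //.
exact: (integrable_lty measurableT iX).
Qed.

Let mean (X : Omega -> R) c := \int[conditioned lab c]_w X w.

Let mean_Lfun2 X : X \in Lfun P 2%:E ->
  (fun w => mean X (lab w)) \in Lfun P 2%:E.
Proof.
by move=> X2; exact: (conditional_mean_Lfun2 labK (Lfun2_measurable X2) X2).
Qed.

Let mean_pull X (a : discrete_space C -> R) : X \in Lfun P 2%:E ->
  a \o lab \in Lfun P 2%:E ->
  \int[P]_w (a (lab w) * X w) = \int[P]_w (a (lab w) * mean X (lab w)).
Proof.
move=> X2 a2.
by rewrite (Rintegral_conditional_mean labK (Lfun2_measurable X2) X2).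
Qed.

Variables (f : S1 * discrete_space C -> R) (g : S2 -> R).
Hypotheses (mf : measurable_fun setT f) (mg : measurable_fun setT g).
Let X w := f (U w, lab w).
Let Y w := g (V w).
Hypotheses (X2 : X \in Lfun P 2%:E) (Y2 : Y \in Lfun P 2%:E).

Let cond_cov c :
  (\int[conditioned lab c]_w ((X w - mean X c) * (Y w - mean Y c))) ^+ 2 <=
  rho2_max * \int[conditioned lab c]_w ((X w - mean X c) ^+ 2) *
   \int[conditioned lab c]_w ((Y w - mean Y c) ^+ 2).
Proof.
have mfc : measurable_fun setT (fun x => f (x, c)).
  exact: (measurableT_comp mf (pair2_measurable (c : discrete_space C))).
have := @covariance_le_maximal_correlation_ae _ _ _ _ _ _ _ (conditioned lab c)
  U V X (fun x => f (x, c)) g (measurable_funPT U) mfc mg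
  (conditioned_Lfun2 X2 c) (conditioned_Lfun2 Y2 c).
move=> /(_ _)/le_trans; rewrite -mulrA; apply.
  by apply: filterS (conditioned_label_ae c) => w wc; rewrite /X wc.
rewrite ler_wpM2r//; last exact: rho2_le_max.
by rewrite mulr_ge0 ?integral_sqr_ge0.
Qed.

Let Xb w := mean X (lab w).
Let Yb w := mean Y (lab w).
Let Xb2 : Xb \in Lfun P 2%:E := mean_Lfun2 X2.
Let Yb2 : Yb \in Lfun P 2%:E := mean_Lfun2 Y2.
Let XXb2 : (fun w => X w - Xb w) \in Lfun P 2%:E := Lfun2B X2 Xb2.
Let YYb2 : (fun w => Y w - Yb w) \in Lfun P 2%:E := Lfun2B Y2 Yb2.

Let within :
  (\int[P]_w ((X w - Xb w) * (Y w - Yb w))) ^+ 2 <=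
  rho2_max * \int[P]_w ((X w - Xb w) ^+ 2) * \int[P]_w ((Y w - Yb w) ^+ 2).
Proof.
apply: discriminant_le0; first exact: integral_sqr_ge0.
move=> t.
rewrite (_ : _ - _ + _ =
    rho2_max * \int[P]_w ((X w - Xb w) ^+ 2) +
    (- (2 * t)) * \int[P]_w ((X w - Xb w) * (Y w - Yb w)) +
    t ^+ 2 * \int[P]_w ((Y w - Yb w) ^+ 2)); last by ring.
rewrite -Rintegral_quadratic//.
pose phi (z : discrete_space C * Omega) :=
  rho2_max * (X z.2 - mean X z.1) ^+ 2 +
  (- (2 * t)) * ((X z.2 - mean X z.1) * (Y z.2 - mean Y z.1)) +
  t ^+ 2 * (Y z.2 - mean Y z.1) ^+ 2.
have mmean Z : measurable_fun setT
    (fun z : discrete_space C * Omega => mean Z z.1).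
  by apply: (@measurableT_comp _ _ _ _ _ _ (mean Z : discrete_space C -> R)).
have mdiff Z : Z \in Lfun P 2%:E -> measurable_fun setT
    (fun z : discrete_space C * Omega => Z z.2 - mean Z z.1).
  move=> Z2; apply: measurable_funB => //.
  by apply: measurableT_comp => //; exact: Lfun2_measurable Z2.
have mphi : measurable_fun setT phi.
  apply: measurable_funD; first apply: measurable_funD.
  - by apply: measurable_funM => //; apply: measurable_funX; exact: mdiff.
  - by apply: measurable_funM => //; apply: measurable_funM; exact: mdiff.
  - by apply: measurable_funM => //; apply: measurable_funX; exact: mdiff.
have iphi : P.-integrable setT (fun w => (phi (lab w, idRV w))%:E).
  have Z (r : R) Z : P.-integrable setT (EFin \o Z) ->
    P.-integrable setT (EFin \o (fun w => r * Z w)) by exact: integrableZl.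
  have i1 := Z rho2_max _ (Lfun2_integrable_sqr XXb2).
  have i2 := Z (- (2 * t)) _ (Lfun2_integrableM XXb2 YYb2).
  have i3 := Z (t ^+ 2) _ (Lfun2_integrable_sqr YYb2).
  exact: (integrableD measurableT (integrableD measurableT i1 i2) i3).
rewrite -[leRHS]/(\int[P]_w phi (lab w, idRV w)) (disintegration labK mphi iphi).
apply: Rintegral_ge0 => w _.
have Xc := Lfun2_center (mean X (lab w)) (conditioned_Lfun2 X2 (lab w)).
have Yc := Lfun2_center (mean Y (lab w)) (conditioned_Lfun2 Y2 (lab w)).
rewrite -[leRHS]/(\int[conditioned lab (lab w)]_v phi (lab w, v)).
rewrite /phi/= (Rintegral_quadratic _ _ _ Xc Yc).
have := quadratic_ge0 t (mulr_ge0 rho2_max_ge0 (integral_sqr_ge0 _ _))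
  (integral_sqr_ge0 _ _) (cond_cov (lab w)).
by congr (0 <= _); ring.
Qed.

Hypothesis Y0 : \int[P]_w Y w = 0.

Let between : \int[P]_w (Yb w ^+ 2) <= rho2_lab * \int[P]_w (Y w ^+ 2).
Proof.
have mm : measurable_fun setT (mean Y : discrete_space C -> R) by [].
have := covariance_le_maximal_correlation mm mg Yb2 Y2.
rewrite -/rho2_lab -/(Y _) Y0 mulr0 subr0 expr0n/= subr0.
have -> : \int[P]_w (mean Y (lab w) * g (V w)) = \int[P]_w (Yb w ^+ 2).
  rewrite (mean_pull (a := mean Y) Y2 Yb2).
  by apply: eq_Rintegral => w _; rewrite expr2.
have [->|Yb0] := eqVneq (\int[P]_w (Yb w ^+ 2)) 0.
  move=> _; rewrite mulr_ge0 ?integral_sqr_ge0//.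
  exact: maximal_correlation2_ge0.
have {}Yb0 : 0 < \int[P]_w (Yb w ^+ 2).
  by rewrite lt_neqAle eq_sym Yb0 integral_sqr_ge0.
move=> h; rewrite -(ler_pM2l Yb0) -expr2 (le_trans h)// [leLHS]mulrCA.
apply: ler_wpM2r.
  by apply: mulr_ge0; [exact: maximal_correlation2_ge0|exact: integral_sqr_ge0].
by rewrite lerBlDr lerDl sqr_ge0.
Qed.

Let pull_cross (Z Z' : Omega -> R) :
  Z \in Lfun P 2%:E -> Z' \in Lfun P 2%:E ->
  \int[P]_w ((Z w - mean Z (lab w)) * (Z' w - mean Z' (lab w))) =
  \int[P]_w (Z w * Z' w) - \int[P]_w (mean Z (lab w) * mean Z' (lab w)).
Proof.
move=> Z2 Z'2; rewrite Rintegral_mulB ?mean_Lfun2//.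
rewrite (mean_pull (a := mean Z) Z'2 (mean_Lfun2 Z2)).
rewrite (_ : \int[P]_w (Z w * mean Z' (lab w)) =
  \int[P]_w (mean Z (lab w) * mean Z' (lab w))); first by ring.
transitivity (\int[P]_w (mean Z' (lab w) * Z w)).
  by apply: eq_Rintegral => w _; rewrite mulrC.
rewrite (mean_pull (a := mean Z') Z2 (mean_Lfun2 Z'2)).
by apply: eq_Rintegral => w _; rewrite mulrC.
Qed.

Let sqrE (Z : Omega -> R) : \int[P]_w (Z w ^+ 2) = \int[P]_w (Z w * Z w).
Proof. by apply: eq_Rintegral => w _; rewrite expr2. Qed.

Lemma centered_mixture_bound : (\int[P]_w (X w * Y w)) ^+ 2 <=
  (rho2_lab + (1 - rho2_lab) * rho2_max) *
  (\int[P]_w (X w ^+ 2) * \int[P]_w (Y w ^+ 2)).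
Proof.
have := within; have := between.
rewrite (sqrE (fun w => X w - Xb w)) (sqrE (fun w => Y w - Yb w)) !pull_cross//.
rewrite -/Xb -/Yb -!sqrE.
set x := \int[P]_w (X w ^+ 2); set y := \int[P]_w (Y w ^+ 2).
set x0 := \int[P]_w (Xb w ^+ 2); set y0 := \int[P]_w (Yb w ^+ 2).
set e := \int[P]_w (Xb w * Yb w); set xy := \int[P]_w (X w * Y w).
move=> y0_le iab.
have eab : e ^+ 2 <= x0 * y0 := cauchy_schwarz Xb2 Yb2.
have x0_ge0 : 0 <= x0 := integral_sqr_ge0 _ _.
have y0_ge0 : 0 <= y0 := integral_sqr_ge0 _ _.
have x1_ge0 : 0 <= x - x0.
  have := integral_sqr_ge0 P (fun w => X w - Xb w).
  by rewrite (sqrE (fun w => X w - Xb w)) pull_cross// -!sqrE.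
have y1_ge0 : 0 <= rho2_max * (y - y0).
  rewrite mulr_ge0 ?rho2_max_ge0//.
  have := integral_sqr_ge0 P (fun w => Y w - Yb w).
  by rewrite (sqrE (fun w => Y w - Yb w)) pull_cross// -!sqrE.
rewrite -mulrA mulrCA in iab.
have := sqr_sum_le x0_ge0 x1_ge0 y0_ge0 y1_ge0 eab iab.
rewrite addrC subrK [x0 + _]addrC subrK => /le_trans; apply.
rewrite mulrCA ler_wpM2l ?integral_sqr_ge0//.
rewrite -subr_ge0 [leRHS](_ : _ = (1 - rho2_max) * (rho2_lab * y - y0)).
  by rewrite mulr_ge0// subr_ge0// rho2_max_le1.
by ring.
Qed.

End mixture.

Lemma maximal_correlation2_mixture_le d1 d2 (S1 : measurableType d1)
    (S2 : measurableType d2) (R : realType) (C : pointedType)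
    (Ccountable : countable [set: C]) dO (Omega : measurableType dO)
    (P : probability Omega R) (lab : {RV P >-> discrete_space C})
    (U : {RV P >-> S1}) (V : {RV P >-> S2}) :
  (forall c, (0 < P (lab @^-1` [set c]))%E) ->
  let rho2_max := sup [set maximal_correlation2 (conditioned lab c) U V |
    c in [set: C]] in
  maximal_correlation2 P (fun w => (U w, lab w)) V <=
  maximal_correlation2 P lab V +
  (1 - maximal_correlation2 P lab V) * rho2_max.
Proof.
move=> lab_gt0 /=.
set rl := maximal_correlation2 P lab V; set rm := sup _.
have k0 : 0 <= rl + (1 - rl) * rm.
  rewrite addr_ge0 ?mulr_ge0 ?maximal_correlation2_ge0//.
    by rewrite subr_ge0 maximal_correlation2_le1.
  exact: rho2_max_ge0.
rewrite {1}/maximal_correlation2; set A := (X in sup X <= _).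
have [[r Ar]|A0] := pselect (A !=set0); last first.
  by rewrite sup_out// => -[].
apply: ge_sup; first by exists r.
move=> _ [f [g [[mf mg] [f2 g2] _ ->]]].
rewrite correlationE//=; set v := (X in _ / X).
have v0 : 0 <= v.
  by rewrite mulr_ge0// subr_ge0; [exact: (sqr_Rintegral_le f2)|exact: (sqr_Rintegral_le g2)].
have [->|vN0] := eqVneq v 0; first by rewrite invr0 mulr0.
rewrite ler_pdivrMr; last by rewrite lt_neqAle eq_sym vN0.
set mf' := \int[P]_w f (U w, lab w); set mg' := \int[P]_w g (V w).
have := @centered_mixture_bound _ _ _ _ _ _ Ccountable _ _ P lab lab_gt0 U V
  (fun z => f z - mf') (fun y => g y - mg').
move=> /(_ _ _ (Lfun2_center mf' f2) (Lfun2_center mg' g2) _).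
have sq (Z : Omega -> R) m : \int[P]_w ((Z w - m) ^+ 2) =
    \int[P]_w ((Z w - m) * (Z w - m)).
  by apply: eq_Rintegral => w _; rewrite expr2.
have sq' (Z : Omega -> R) : \int[P]_w (Z w ^+ 2) = \int[P]_w (Z w * Z w).
  by apply: eq_Rintegral => w _; rewrite expr2.
rewrite (sq (fun w => f (U w, lab w))) (sq (g \o V)).
rewrite (Rintegral_center f2 g2) (Rintegral_center f2 f2) (Rintegral_center g2 g2) /=.
rewrite -/mf' -/mg' -!sq' -!expr2; apply.
- by apply: measurable_funB.
- by apply: measurable_funB.
- rewrite RintegralB//; last exact: finite_measure_integrable_cst.
    by rewrite Rintegral_probability_cst subrr.
  exact: Lfun2_integrable g2.
Qed.

Lemma measurable_kernel_Rintegral d1 d2 (S1 : measurableType d1)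
    (S2 : measurableType d2) (R : realType) (k : R.-ker S1 ~> S2) (f : S2 -> R) :
  measurable_fun setT f -> measurable_fun setT (fun x => \int[k x]_y f y).
Proof.
move=> mf; apply: measurableT_comp => //.
under eq_fun => x do rewrite integralE.
by apply: emeasurable_funB;
  apply: (measurable_fun_integral_kernel (measurable_kernel k)) => //;
  [apply: measurable_funepos|apply: measurable_funeneg];
  exact/measurable_EFinP.
Qed.

Section kernel_composition.
Context d0 d1 d2 (S0 : measurableType d0) (S1 : measurableType d1)
  (S2 : measurableType d2) (R : realType).
Variables (Q : R.-pker S0 ~> S1) (K : R.-pker S1 ~> S2) (x : S0).

Lemma integral_mkcomp_noparam (f : S2 -> \bar R) :
  (forall z, 0 <= f z)%E -> measurable_fun setT f ->
  (\int[mkcomp_noparam Q K x]_z f z = \int[Q x]_y \int[K y]_z f z)%E.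
Proof. by move=> f0 mf; exact: (integral_kcomp Q (kernel.kernel_snd K)). Qed.

Lemma Rintegral_mkcomp_noparam (f : S2 -> R) : measurable_fun setT f ->
  (\int[Q x]_y \int[K y]_z `|(f z)%:E| < +oo)%E ->
  \int[mkcomp_noparam Q K x]_z f z = \int[Q x]_y \int[K y]_z f z.
Proof.
move=> mf foo.
have mEf : measurable_fun setT (EFin \o f) by exact/measurable_EFinP.
have mI (g : S2 -> \bar R) : (forall z, 0 <= g z)%E -> measurable_fun setT g ->
    measurable_fun setT (fun y => \int[K y]_z g z)%E.
  by move=> g0 mg; exact: (measurable_fun_integral_kernel (measurable_kernel K)).
have integrable_part (g : S2 -> \bar R) :
    (forall z, 0 <= g z)%E -> measurable_fun setT g ->
    (forall z, g z <= `|(f z)%:E|)%E ->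
    (Q x).-integrable setT (fun y => \int[K y]_z g z)%E.
  move=> g0 mg gf; apply/integrableP; split; first exact: mI.
  apply: le_lt_trans foo; apply: ge0_le_integral => //.
  - by apply: measurableT_comp => //; exact: mI.
  - by apply: mI => //; exact: measurableT_comp.
  - move=> y _; rewrite gee0_abs ?integral_ge0//.
    by apply: ge0_le_integral => //; exact: measurableT_comp.
have mp := measurable_funepos mEf; have mn := measurable_funeneg mEf.
have ipos : (Q x).-integrable setT (fun y => \int[K y]_z (EFin \o f)^\+ z)%E.
  by apply: integrable_part => // z; rewrite funeposE ge_max lee_abs abse_ge0.
have ineg : (Q x).-integrable setT (fun y => \int[K y]_z (EFin \o f)^\- z)%E.
  by apply: integrable_part => // z; rewrite funenegE ge_max -abseN lee_abs abse_ge0.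
congr fine; rewrite integralE !integral_mkcomp_noparam//.
rewrite -integralB//; apply: ae_eq_integral => //.
- exact: measurable_int (integrableB measurableT ipos ineg).
- by apply/measurable_EFinP; exact: measurable_kernel_Rintegral.
- have posfin := integrable_ae measurableT ipos.
  have negfin := integrable_ae measurableT ineg.
  apply: filterS2 posfin negfin => y /(_ I) yp /(_ I) yn _.
  have fE : (\int[K y]_z (f z)%:E = \int[K y]_z (EFin \o f)^\+ z -
      \int[K y]_z (EFin \o f)^\- z)%E by rewrite integralE.
  by rewrite /Rintegral fE fineK// fin_numB yp yn.
Qed.

End kernel_composition.

Section two_step_chain.
Context d1 d2 (S1 : measurableType d1) (S2 : measurableType d2) (R : realType).
Context dO (Omega : measurableType dO) (P : probability Omega R).
Variables (X : {RV P >-> S1}) (V : {RV P >-> S2}).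
Variables (Q : R.-pker S1 ~> S2) (K : R.-pker S2 ~> S1).
Hypothesis XVQ : conditional_law P X V (fun x => Q x).
Hypothesis VXK : conditional_law P V X (fun y => K y).
Variable f : S1 -> R.
Hypotheses (mf : measurable_fun setT f) (f2 : f \o X \in Lfun P 2%:E).

Let h y := \int[K y]_x f x.

Let mh : measurable_fun setT h.
Proof. exact: measurable_kernel_Rintegral. Qed.

Let h2 : h \o V \in Lfun P 2%:E.
Proof. exact: (conditional_mean_Lfun2 VXK mf f2). Qed.

Lemma measurable_markov_operator :
  measurable_fun setT (markov_operator (mkcomp_noparam Q K) f).
Proof. exact: measurable_kernel_Rintegral. Qed.

Let markov_operatorE :
  {ae P, forall w, markov_operator (mkcomp_noparam Q K) f (X w) =
    \int[Q (X w)]_y h y}.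
Proof.
have mabs : measurable_fun setT (fun x => `|(f x)%:E|%E).
  by apply: measurableT_comp => //; exact/measurable_EFinP.
have mI : measurable_fun setT (fun y => \int[K y]_x `|(f x)%:E|)%E.
  exact: (measurable_fun_integral_kernel (measurable_kernel K)).
have mI2 : measurable_fun setT
    (fun z : S1 * S2 => \int[K z.2]_x `|(f x)%:E|)%E.
  exact: (measurableT_comp mI measurable_snd).
have mabs2 : measurable_fun setT (fun z : S2 * S1 => `|(f z.2)%:E|%E).
  exact: (measurableT_comp mabs measurable_snd).
have foo : (\int[P]_w \int[K (V w)]_x `|(f x)%:E| < +oo)%E.
  rewrite -(ge0_disintegration VXK (phi := fun z => `|(f z.2)%:E|%E))//.
  by have /integrableP[] := Lfun2_integrable f2.
have I0 (z : S1 * S2) : (0 <= \int[K z.2]_x `|(f x)%:E|)%E.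
  by apply: integral_ge0 => x _.
have := ge0_disintegration_integrable XVQ I0 mI2 foo.
move=> /(integrable_ae measurableT); apply: filterS => w /(_ I) wfin.
apply: Rintegral_mkcomp_noparam => //.
by rewrite -ge0_fin_numE//; apply: integral_ge0 => y _; exact: (I0 (X w, y)).
Qed.

Let Rintegral_backward_mean :
  \int[P]_w (f (X w) * h (V w)) = \int[P]_w (h (V w) ^+ 2).
Proof.
transitivity (\int[P]_w (h (V w) * f (X w))).
  by apply: eq_Rintegral => w _; rewrite mulrC.
rewrite (Rintegral_conditional_mean VXK mf f2 mh h2).
by apply: eq_Rintegral => w _; rewrite expr2.
Qed.

Lemma Rintegral_markov_operator :
  \int[P]_w (f (X w) * markov_operator (mkcomp_noparam Q K) f (X w)) =
  \int[P]_w (\int[K (V w)]_x f x) ^+ 2.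
Proof.
have mfX := Lfun2_measurable f2.
transitivity (\int[P]_w (f (X w) * \int[Q (X w)]_y h y)).
  apply: ae_eq_Rintegral.
  - apply: measurable_funM => //.
    exact: (measurableT_comp measurable_markov_operator (measurable_funPT X)).
  - apply: measurable_funM => //.
    exact: (measurableT_comp (measurable_kernel_Rintegral Q mh) (measurable_funPT X)).
  - by apply: filterS markov_operatorE => w ->.
rewrite -(Rintegral_conditional_mean XVQ mh h2 mf f2).
exact: Rintegral_backward_mean.
Qed.

Lemma Rintegral_markov_operator_le d3 (S3 : measurableType d3)
    (L : Omega -> S3) (g : S3 -> S1) : measurable_fun setT g ->
  (forall w, g (L w) = X w) -> \int[P]_w f (X w) = 0 ->
  \int[P]_w (f (X w) * markov_operator (mkcomp_noparam Q K) f (X w)) <=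
  maximal_correlation2 P L V * \int[P]_w (f (X w) ^+ 2).
Proof.
move=> mg gL f0; rewrite Rintegral_markov_operator.
have mfg : measurable_fun setT (f \o g) by exact: measurableT_comp.
have fgE : f \o g \o L = f \o X by apply/funext => w /=; rewrite gL.
have fg2 : f \o g \o L \in Lfun P 2%:E by rewrite fgE.
have := covariance_le_maximal_correlation mfg mh fg2 h2.
have -> : \int[P]_w (f \o g) (L w) = 0.
  by rewrite -[RHS]f0; apply: eq_Rintegral => w _ /=; rewrite gL.
have -> : \int[P]_w (f \o g) (L w) ^+ 2 = \int[P]_w (f (X w) ^+ 2).
  by apply: eq_Rintegral => w _ /=; rewrite gL.
have -> : \int[P]_w ((f \o g) (L w) * h (V w)) = \int[P]_w (h (V w) ^+ 2).
  rewrite -Rintegral_backward_mean.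
  by apply: eq_Rintegral => w _ /=; rewrite gL.
rewrite mul0r subr0 expr0n/= subr0.
set b := \int[P]_w (h (V w) ^+ 2); set a := \int[P]_w (f (X w) ^+ 2).
have a0 : 0 <= a := integral_sqr_ge0 _ _.
have b0 : 0 <= b := integral_sqr_ge0 _ _.
set r := maximal_correlation2 P L V.
have ra0 : 0 <= r * a by rewrite mulr_ge0// maximal_correlation2_ge0.
move=> bab; rewrite -/b.
have [->//|bN0] := eqVneq b 0.
have b_gt0 : 0 < b by rewrite lt_neqAle eq_sym bN0.
rewrite -(ler_pM2l b_gt0) -expr2 (le_trans bab)// mulrA [leRHS]mulrC.
by rewrite ler_wpM2l// lerBlDr lerDl sqr_ge0.
Qed.

End two_step_chain.

Lemma Rintegral_law d1 (S1 : measurableType d1) (R : realType) dO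
    (Omega : measurableType dO) (P : probability Omega R)
    (X : {RV P >-> S1}) (p : probability S1 R) (phi : S1 -> R) :
  (forall A, measurable A -> P (X @^-1` A) = p A) -> measurable_fun setT phi ->
  \int[p]_x phi x = \int[P]_w phi (X w).
Proof.
move=> law mphi; rewrite /Rintegral; congr fine.
have mE : measurable_fun setT (EFin \o phi) by exact/measurable_EFinP.
transitivity (\int[distribution P X]_x (phi x)%:E)%E.
  by apply: eq_measure_integral => A mA _; exact: esym (law A mA).
rewrite [LHS]integralE [RHS]integralE; congr (_ - _)%E.
  rewrite ge0_integral_distribution//; last exact: measurable_funepos.
  by apply: eq_integral => w _; rewrite /= !funeposE.
rewrite ge0_integral_distribution//; last exact: measurable_funeneg.
by apply: eq_integral => w _; rewrite /= !funenegE.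
Qed.

Lemma Lfun2_law d1 (S1 : measurableType d1) (R : realType) dO
    (Omega : measurableType dO) (P : probability Omega R)
    (X : {RV P >-> S1}) (p : probability S1 R) (phi : S1 -> R) :
  (forall A, measurable A -> P (X @^-1` A) = p A) ->
  phi \in Lfun p 2%:E -> phi \o X \in Lfun P 2%:E.
Proof.
move=> law /Lfun2P[mphi phioo]; apply/Lfun2P; split.
  exact: measurableT_comp.
apply: le_lt_trans phioo; rewrite le_eqVlt; apply/orP; left; apply/eqP.
transitivity (\int[distribution P X]_x (phi x ^+ 2)%:E)%E.
  rewrite ge0_integral_distribution//.
    by apply/measurable_EFinP; exact: measurable_funX.
  by move=> x; rewrite lee_fin sqr_ge0.
by apply: eq_measure_integral => A mA _; exact: law.
Qed.

Lemma law_of_mixture (R : realType) (C : pointedType) d1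
    (S1 : measurableType d1) (Ccountable : countable [set: C]) dO
    (Omega : measurableType dO) (P : probability Omega R)
    (lab : {RV P >-> discrete_space C}) (X : {RV P >-> S1})
    (w : C -> R) (k : C -> set S1 -> \bar R) :
  (forall c, P (lab @^-1` [set c]) = (w c)%:E) ->
  (forall c A, 0 <= k c A)%E -> conditional_law P lab X k ->
  forall A, measurable A ->
  P (X @^-1` A) = (\esum_(c in [set: C]) ((w c)%:E * k c A))%E.
Proof.
move=> labE k0 labX A mA.
have [mk /(_ setT measurableT)] := labX A mA.
rewrite preimage_setT setTI => ->.
rewrite -(preimage_setT lab) (ge0_integral_countable_label Ccountable)//; last first.
  exact: (measurableT_comp mk (measurable_funPT lab)).
apply: eq_esum => c _.
rewrite (eq_integral (cst (k c A))); last by move=> v /set_mem /= ->.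
rewrite integral_cst//; last exact: measurable_funPTI.
by rewrite [X in (_ * X)%E]labE muleC.
Qed.

Theorem mainTheorem2 (R : realType) (d : nat)
    (C : pointedType) (Ccountable : countable [set: C])
    (w : C -> R) (w_gt0 : forall c, 0 < w c)
    (w_sum : (\esum_(c in [set: C]) (w c)%:E = 1)%E)
    (f : C -> d.-tuple R -> R) (f_density : forall c, probability_density (f c))
    (p : probability (d.-tuple R) R)
    (p_mixture : forall A, measurable A ->
       p A = (\esum_(c in [set: C]) ((w c)%:E * density_law (f c) A))%E)
    (p_C1 : exists q : d.-tuple R -> R,
       [/\ probability_density q, continuously_differentiable q
         & forall A, measurable A -> p A = density_law q A])
    (T alpha : R) (T_gt0 : 0 < T) (alphaE : alpha = expR (- T))
    (dO : measure_display) (Omega : measurableType dO)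
    (P : probability Omega R)
    (lab : {RV P >-> discrete_space C})
    (X0 XT : {RV P >-> d.-tuple R})
    (lab_law : forall c, P (lab @^-1` [set c]) = (w c)%:E)
    (X0_law : conditional_law P lab X0 (fun c => density_law (f c)))
    (XT_law : conditional_law P (fun u => (X0 u, lab u)) XT
       (fun z => isotropic_gaussian
          [tuple Num.sqrt alpha * tnth z.1 i | i < d] (Num.sqrt (1 - alpha)))) :
  let rho2_joint := maximal_correlation2 P (fun u => (X0 u, lab u)) XT in
  let rho2_lab := maximal_correlation2 P lab XT in
  let rho2 c := maximal_correlation2 (conditioned lab c) X0 XT in
  let rho2_max := sup [set rho2 c | c in [set: C]] in
  rho2_joint <= rho2_lab + (1 - rho2_lab) * rho2_max /\
  forall (Q K : R.-pker (d.-tuple R) ~> (d.-tuple R)),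
    conditional_law P X0 XT (fun x => Q x) ->
    conditional_law P XT X0 (fun y => K y) ->
    (((1 - rho2_lab) * (1 - rho2_max))%:E <=
       spectral_gap p (mkcomp_noparam Q K))%E.
Proof.
move=> rho2_joint rho2_lab rho2 rho2_max.
have lab_gt0 c : (0 < P (lab @^-1` [set c]))%E by rewrite lab_law lte_fin.
have joint_le : rho2_joint <= rho2_lab + (1 - rho2_lab) * rho2_max.
  exact: maximal_correlation2_mixture_le.
split => // Q K XQ XK.
have law_p A : measurable A -> P (X0 @^-1` A) = p A.
  move=> mA; rewrite p_mixture//.
  apply: (law_of_mixture Ccountable lab_law) X0_law _ mA.
  move=> c B; apply: integral_ge0 => x _; rewrite lee_fin.
  by have [_ -> _] := f_density c.
rewrite (_ : (1 - rho2_lab) * (1 - rho2_max) =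
  1 - (rho2_lab + (1 - rho2_lab) * rho2_max)); last by ring.
rewrite /spectral_gap EFinB; apply: leeB => //.
apply: ge_ereal_sup => _ [phi [phi2 phi0 _] <-]; rewrite lee_fin.
have mphi := Lfun2_measurable phi2.
have phiX2 := Lfun2_law law_p phi2.
have mM := measurable_markov_operator Q K mphi.
rewrite (Rintegral_law law_p (measurable_funM mphi mM)).
rewrite (Rintegral_law law_p (measurable_funX 2 mphi)).
have phiX0 : \int[P]_w phi (X0 w) = 0 by rewrite -(Rintegral_law law_p mphi).
have := Rintegral_markov_operator_le XQ XK mphi phiX2
  (L := fun u => (X0 u, lab u)) measurable_fst (fun=> erefl) phiX0.
rewrite -/rho2_joint; set a := \int[P]_w (phi (X0 w) ^+ 2) => le_a.
have [->|aN0] := eqVneq a 0.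
  rewrite invr0 mulr0 (le_trans _ joint_le)//.
  exact: maximal_correlation2_ge0.
have a_gt0 : 0 < a by rewrite lt_neqAle eq_sym aN0 integral_sqr_ge0.
rewrite ler_pdivrMr// (le_trans le_a)//.
by apply: ler_wpM2r => //; exact: ltW.
Qed.
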